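(* Let the transmitter positions $\alpha_1,\dots,\alpha_{N_T}$ and the receiver positions $\beta_1,\dots,\beta_{N_R}$ be drawn i.i.d. from even (symmetric about $0$) distributions $\mathcal{P}_\alpha$ on $[-A_T/A,A_T/A]$ and $\mathcal{P}_\beta$ on $[-A_R/A,A_R/A]$, respectively. Let the chirp indices $\zeta_1,\dots,\zeta_P\in\{0,1,\dots,P_{max}-1\}$ be distinct and (identically) distributed as $\mathcal{P}_p$, a distribution symmetric about $(P_{max}-1)/2$. Let the Doppler grid $\rho_1,\dots,\rho_{G_D}$ be uniform (equally spaced) and let the angular grid $\phi_1,\dots,\phi_{G_\theta}$ be uniform in the $\sin\theta$ domain (i.e. $\sin\phi_1,\dots,\sin\phi_{G_\theta}$ are equally spaced). Define the random variable $\xi=\alpha+\beta$. Then the random matrix $\mathbf{D}=\mathbf{B}\otimes\mathbf{C}$ satisfies the isotropy property $$\mathbb{E}[\mathbf{D}_{l,:}^H\mathbf{D}_{l,:}]=\mathbf{I}\quad\text{for every }1\le l\le PN_TN_R$$ if and only if $$\Psi_p(u^D_{1,i})=0\ \text{ for } i=2,3,\dots,G_D\quad\text{and}\quad\Psi_\xi(u^\theta_{1,j})=0\ \text{ for } j=2,3,\dots,G_\theta,$$ where $\Psi_p$ and $\Psi_\xi$ denote the characteristic functions of $\mathcal{P}_p$ and of $\xi$.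
   Context: Parameters: $\lambda>0$ (wavelength), $T_c>0$ (chirp duration), apertures $A_T,A_R>0$ with $A=A_T+A_R$, positive integers $N_T,N_R$ (transmitters, receivers), $P<P_{max}$ (transmitted chirps, maximal number of chirps), $G_D,G_\theta$ (numbers of grid points). In exponents $j$ is the imaginary unit. The chirp indices $\zeta_p$ are independent of the positions $\alpha_n,\beta_m$. In $\xi=\alpha+\beta$, $\alpha\sim\mathcal{P}_\alpha$ and $\beta\sim\mathcal{P}_\beta$ stand for a generic transmitter and a generic receiver position, so that $\xi$ has the (common) distribution of the sums $\alpha_n+\beta_m$. $\mathbf{B}$ is the $P\times G_D$ matrix whose $i$-th column is $[\exp(j\frac{4\pi T_c}{\lambda}\rho_i\zeta_1),\dots,\exp(j\frac{4\pi T_c}{\lambda}\rho_i\zeta_P)]^T$. $\mathbf{C}$ is the $N_TN_R\times G_\theta$ matrix whose $i$-th column has entries $\exp(j\frac{\pi A}{\lambda}\sin(\phi_i)(\alpha_n+\beta_m))$, one for each pair $(n,m)$ with $1\le n\le N_T$, $1\le m\le N_R$ (in a fixed order). $\mathbf{D}=\mathbf{B}\otimes\mathbf{C}$ is their Kronecker product, a $PN_TN_R\times G_DG_\theta$ matrix, and $\mathbf{D}_{l,:}$ denotes its $l$-th row (a row vector). Notation: $u^D_{i_1,i_2}=\frac{4\pi T_c}{\lambda}(\rho_{i_2}-\rho_{i_1})$ and $u^\theta_{i_1,i_2}=\frac{\pi A}{\lambda}(\sin\phi_{i_2}-\sin\phi_{i_1})$. The characteristic function of a random variable $X$ is $\Psi_X(u)=\mathbb{E}[e^{juX}]$.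 *)

(* Defs.v *)
From HB Require Import structures.
From mathcomp Require Import all_boot all_order all_algebra.
From mathcomp Require Import spectral complex mxtens.
From mathcomp Require Import all_classical all_reals all_analysis.

Set Implicit Arguments.
Unset Strict Implicit.
Unset Printing Implicit Defensive.

Import Order.TTheory GRing.Theory Num.Theory.
Import numFieldNormedType.Exports.

Local Open Scope classical_set_scope.
Local Open Scope ring_scope.

Section Probability.
Context {d : measure_display} {T : measurableType d} {R : realType}.
Variable P : probability T R.

(* The real and imaginary parts are integrated separately; [fine] sends an
   infinite expectation to 0, which is harmless for bounded [Z]. *)
Definition cexpectation (Z : T -> R[i]) : R[i] :=
  (fine 'E_P[fun w => complex.Re (Z w)]
    +i* fine 'E_P[fun w => complex.Im (Z w)])%C.

Definition mxexpectation m n (M : T -> 'M[R[i]]_(m, n)) : 'M[R[i]]_(m, n) :=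
  \matrix_(k, l) cexpectation (fun w => M w k l).

Definition mutually_independent (I : finType) (X : I -> T -> R) : Prop :=
  forall (J : {set I}) (B : I -> set R), (forall i, measurable (B i)) ->
    P (\bigcap_(i in [set` J]) (X i @^-1` B i)) =
    (\prod_(i in J) P (X i @^-1` B i))%E.

Definition sigma_of_family (I : Type) (X : I -> T -> R) : set (set T) :=
  <<s [set A | exists i (B : set R), measurable B /\ A = X i @^-1` B] >>.

Definition independent_families (I J : Type)
    (X : I -> T -> R) (Y : J -> T -> R) : Prop :=
  forall A B, sigma_of_family X A -> sigma_of_family Y B ->
    P (A `&` B) = (P A * P B)%E.

End Probability.

Definition join_families (I J A : Type) (f : I -> A) (g : J -> A)
    (k : I + J) : A :=
  match k with inl i => f i | inr j => g j end.

(* [expj t] is exp(j t), j being the imaginary unit. *)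
Definition expj {R : realType} (t : R) : R[i] := (cos t +i* sin t)%C.

(* The characteristic function of a law [mu] on [R] is [charfun mu idfun]. *)
Definition charfun {d : measure_display} {T : measurableType d} {R : realType}
    (P : probability T R) (X : T -> R) (u : R) : R[i] :=
  cexpectation P (fun w => expj (u * X w)).

Definition has_law {d : measure_display} {T : measurableType d} {R : realType}
    (P : probability T R) (X : {RV P >-> R})
    (mu : probability R R) : Prop :=
  forall B : set R, measurable B -> distribution P X B = mu B.

Definition symmetric_about {R : realType} (c : R)
    (mu : probability R R) : Prop :=
  forall B : set R, measurable B ->
    mu ((fun x : R => 2 * c - x) @^-1` B) = mu B.

Definition equally_spaced {R : realType} n (x : 'I_n -> R) : Prop :=
  exists step : R, forall i k : 'I_n, k = i.+1 :> nat -> x k - x i = step.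

Section Radar.
Context {R : realType}.
Variables (lambda Tc A : R) (P NT NR GD GT : nat).

Definition uD (rho : 'I_GD -> R) (i k : 'I_GD) : R :=
  4 * pi * Tc / lambda * (rho k - rho i).

Definition utheta (phi : 'I_GT -> R) (i k : 'I_GT) : R :=
  pi * A / lambda * (sin (phi k) - sin (phi i)).

Definition matB (rho : 'I_GD -> R) (zeta : 'I_P -> R) : 'M[R[i]]_(P, GD) :=
  \matrix_(p, i) expj (4 * pi * Tc / lambda * rho i * zeta p).

(* [pair] is the order in which the pairs (n, m) label the rows. *)
Definition matC (pair : 'I_(NT * NR) -> 'I_NT * 'I_NR) (phi : 'I_GT -> R)
    (alpha : 'I_NT -> R) (beta : 'I_NR -> R) : 'M[R[i]]_(NT * NR, GT) :=
  \matrix_(q, i)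
    expj (pi * A / lambda * sin (phi i) *
          (alpha (pair q).1 + beta (pair q).2)).

Definition matD (rho : 'I_GD -> R) (pair : 'I_(NT * NR) -> 'I_NT * 'I_NR)
    (phi : 'I_GT -> R) (zeta : 'I_P -> R) (alpha : 'I_NT -> R)
    (beta : 'I_NR -> R) : 'M[R[i]]_(P * (NT * NR), GD * GT) :=
  matB rho zeta *t matC pair phi alpha beta.

End Radar.

Definition isotropic {d : measure_display} {T : measurableType d}
    {R : realType} (P : probability T R) m n
    (D : T -> 'M[R[i]]_(m, n)) : Prop :=
  forall l : 'I_m,
    mxexpectation P (fun w => (row l (D w) ^t*)%sesqui *m row l (D w)) = 1%:M.

(* Main.v *)
(* The entry of E[D_l^H D_l] at the columns (i, j) and (k, l') is
   E[exp(j (u^D_{i,k} zeta_p + u^theta_{j,l'} (alpha_n + beta_m)))], which by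
   independence is Psi_p(u^D_{i,k}) Psi_xi(u^theta_{j,l'}).  As Psi(0) = 1,
   isotropy says that this product vanishes off the diagonal; the entries in
   the first row of the two grids give the vanishing conditions, and
   conversely equal spacing together with Psi(-u) = conj(Psi(u)) reduces every
   off-diagonal entry to one of the first row. *)

Require Import Defs.
From HB Require Import structures.
From mathcomp Require Import all_boot all_order all_algebra.
From mathcomp Require Import spectral complex mxtens.
From mathcomp Require Import all_classical all_reals all_analysis.
From mathcomp Require Import measurable_realfun ring.

Set Implicit Arguments.
Unset Strict Implicit.
Unset Printing Implicit Defensive.

Import Order.TTheory GRing.Theory Num.Theory.
Import numFieldNormedType.Exports.

Local Open Scope classical_set_scope.
Local Open Scope ring_scope.

(** * Algebra of [expj] *)

Section ExponentialJ.
Context {R : realType}.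
Implicit Types s t : R.

Lemma expj0 : expj 0 = 1 :> R[i].
Proof. by rewrite /expj cos0 sin0. Qed.

Lemma expjD s t : expj (s + t) = expj s * expj t.
Proof. by rewrite /expj cosD sinD; simpc; rewrite (addrC (sin s * _)). Qed.

Lemma conjc_expj t : (expj t)^* = expj (- t).
Proof. by rewrite /expj cosN sinN. Qed.

End ExponentialJ.

(** * Integrals of bounded measurable functions *)

Section BoundedIntegrable.
Context {d : measure_display} {T : measurableType d} {R : realType}.
Variable P : probability T R.

Lemma bounded_measurable_integrable (f : T -> R) (M : R) :
  measurable_fun setT f -> (forall x, `|f x| <= M) ->
  P.-integrable setT (EFin \o f).
Proof.
move=> mf fM; apply: measurable_bounded_integrable => //.
  by rewrite -ge0_fin_numE// fin_num_measure.
exists M; split; first exact: num_real.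
by move=> x Mx y _; exact: le_trans (fM y) (ltW Mx).
Qed.

Lemma Rintegral_distribution_bounded d' (T' : measurableType d')
    (X : {RV P >-> T'}) (f : T' -> R) (M : R) :
  measurable_fun setT f -> (forall x, `|f x| <= M) ->
  \int[distribution P X]_x f x = \int[P]_w f (X w).
Proof.
move=> mf fM; rewrite /Rintegral integral_distribution//.
  exact/measurable_EFinP.
apply: (bounded_measurable_integrable _ (f := f \o X) (M := M)) => //=.
exact: measurableT_comp.
Qed.

End BoundedIntegrable.

(** Independence tested on Borel preimages alone: both [mutually_independent] (at distinct indices)
    and [independent_families] yield it, and it suffices for factoring expectations. *)
Definition independent_pair {d : measure_display} {T : measurableType d}
    {R : realType} (P : probability T R) (X Y : T -> R) : Prop :=
  forall A B : set R, measurable A -> measurable B ->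
    P (X @^-1` A `&` Y @^-1` B) = (P (X @^-1` A) * P (Y @^-1` B))%E.

(** * Joint law and product expectations of an independent pair *)

Section IndependentPair.
Context {d : measure_display} {T : measurableType d} {R : realType}.
Variables (P : probability T R) (X Y : {RV P >-> R}).
Hypothesis indepXY : independent_pair P X Y.

Let Z (w : T) : R * R := (X w, Y w).

Let mZ : measurable_fun setT Z.
Proof. exact/measurable_fun_pair. Qed.

HB.instance Definition _ := isMeasurableFun.Build _ _ _ _ Z mZ.

(** By independence the joint law has the product values on rectangles, and these values determine
    the product measure. *)
Lemma distribution_pair_independent (A : set (R * R)) : measurable A ->
  distribution P Z A = (distribution P X \x distribution P Y)%E A.
Proof.
move=> mA; apply/esym; apply: product_measure_unique A mA => B C mB mC.
by rewrite -indepXY.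
Qed.

(** The left side integrates [f x * g y] against the joint law, which is a product, so Fubini
    separates the factors; the bounds give integrability. *)
Lemma Rintegral_mul_independent (f g : R -> R) (M N : R) :
  measurable_fun setT f -> measurable_fun setT g ->
  (forall x, `|f x| <= M) -> (forall x, `|g x| <= N) ->
  \int[P]_w (f (X w) * g (Y w)) =
  (\int[P]_w f (X w)) * (\int[P]_w g (Y w)).
Proof.
move=> mf mg fM gN.
pose h (z : R * R) := f z.1 * g z.2.
have mh : measurable_fun setT h.
  by apply: measurable_funM; exact: measurableT_comp.
have hMN z : `|h z| <= M * N by rewrite normrM ler_pM.
have intf : (distribution P X).-integrable setT (EFin \o f).
  exact: bounded_measurable_integrable fM.
have intg : (distribution P Y).-integrable setT (EFin \o g).
  exact: bounded_measurable_integrable gN.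
rewrite -[LHS]/(\int[P]_w h (Z w)).
rewrite -(Rintegral_distribution_bounded X mf fM).
rewrite -(Rintegral_distribution_bounded Y mg gN).
rewrite -(Rintegral_distribution_bounded Z mh hMN) {1}/Rintegral.
rewrite (eq_measure_integral (distribution P X \x distribution P Y)%E);
  last by move=> A mA _; exact: distribution_pair_independent.
rewrite -integral12_prod_meas1; last first.
  exact: (bounded_measurable_integrable _ (f := h)) hMN.
rewrite -RintegralZr//; congr fine; apply: eq_integral => x _.
(* The integral of [g] is finite, so [fine] loses nothing, and the constant [f x] leaves the inner
   integral. *)
rewrite /fubini_F/= /h/= EFinM fineK; last exact: integrable_fin_num.
by rewrite -integralZl.
Qed.

End IndependentPair.

(** * Characteristic functions *)

Section CharacteristicFunction.
Context {R : realType}.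

Lemma measurable_cosM (u : R) : measurable_fun setT (fun x : R => cos (u * x)).
Proof.
apply: (measurableT_comp (f := cos)); last exact: measurable_funM.
by apply: continuous_measurable_fun; exact: continuous_cos.
Qed.

Lemma measurable_sinM (u : R) : measurable_fun setT (fun x : R => sin (u * x)).
Proof.
apply: (measurableT_comp (f := sin)); last exact: measurable_funM.
by apply: continuous_measurable_fun; exact: continuous_sin.
Qed.

Lemma cexpectationE d (T : measurableType d) (P : probability T R)
    (Z : T -> R[i]) :
  cexpectation P Z =
  (\int[P]_w complex.Re (Z w) +i* \int[P]_w complex.Im (Z w))%C.
Proof. by rewrite /cexpectation unlock. Qed.

Context {d : measure_display} {T : measurableType d}.
Variable P : probability T R.

Lemma charfun0 (X : T -> R) : charfun P X 0 = 1.
Proof.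
rewrite /charfun (_ : (fun w => _) = cst 1); last first.
  by apply/funext => w; rewrite mul0r expj0.
by rewrite /cexpectation /= !expectation_cst.
Qed.

(** Cosine is even and sine is odd, so only the imaginary part changes sign. *)
Lemma charfunN (X : {RV P >-> R}) (u : R) :
  charfun P X (- u) = (charfun P X u)^*.
Proof.
rewrite /charfun !cexpectationE /=; congr (_ +i* _)%C.
  by apply: eq_Rintegral => w _; rewrite mulNr cosN.
rewrite -mulN1r -RintegralZl//; first last.
  apply: (bounded_measurable_integrable _ (M := 1)) => [|w].
    by apply: (measurableT_comp (measurable_sinM u)).
  exact: sin_max.
by apply: eq_Rintegral => w _; rewrite mulNr sinN mulN1r.
Qed.

(** Both parts integrate a bounded function of [X], hence depend on its law alone. This allows
    variables on different probability spaces to be compared. *)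
Lemma charfun_law (X : {RV P >-> R}) (mu : probability R R) (u : R) :
  has_law X mu -> charfun P X u = charfun mu idfun u.
Proof.
move=> lawX; rewrite /charfun !cexpectationE /=; congr (_ +i* _)%C.
- rewrite -(Rintegral_distribution_bounded X (measurable_cosM u) (M := 1)).
    by congr fine; apply: eq_measure_integral => A mA _; exact: lawX.
  by move=> x; exact: cos_max.
- rewrite -(Rintegral_distribution_bounded X (measurable_sinM u) (M := 1)).
    by congr fine; apply: eq_measure_integral => A mA _; exact: lawX.
  by move=> x; exact: sin_max.
Qed.

(** The addition formulas split both parts into products of a bounded function of [X] and one of
    [Y]; each expectation factors, and the four terms reassemble into the complex product. *)
Lemma cexpectation_expj_independent (X Y : {RV P >-> R}) (u v : R) :
  independent_pair P X Y ->
  cexpectation P (fun w => expj (u * X w + v * Y w)) =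
  charfun P X u * charfun P Y v.
Proof.
move=> indepXY.
pose factor := Rintegral_mul_independent indepXY.
have int_mul (f g : R -> R) : measurable_fun setT f -> measurable_fun setT g ->
    (forall x, `|f x| <= 1) -> (forall x, `|g x| <= 1) ->
    P.-integrable setT (EFin \o (fun w => f (X w) * g (Y w))).
  move=> mf mg f1 g1; apply: (bounded_measurable_integrable _ (M := 1)).
    by apply: measurable_funM; exact: measurableT_comp.
  by move=> w; rewrite normrM mulr_ile1.
have [mcu mcv] := (measurable_cosM u, measurable_cosM v).
have [msu msv] := (measurable_sinM u, measurable_sinM v).
have cos1 a x : `|cos (a * x : R)| <= 1 := cos_max _.
have sin1 a x : `|sin (a * x : R)| <= 1 := sin_max _.
rewrite /charfun !cexpectationE /=; simpc; congr (_ +i* _)%C.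
- under eq_Rintegral do rewrite cosD.
  rewrite RintegralB//;
    [|exact: int_mul (cos1 _) (cos1 _)|exact: int_mul (sin1 _) (sin1 _)].
  by rewrite (factor _ _ _ _ mcu mcv (cos1 _) (cos1 _))
    (factor _ _ _ _ msu msv (sin1 _) (sin1 _)).
- under eq_Rintegral do rewrite sinD.
  rewrite RintegralD//;
    [|exact: int_mul (sin1 _) (cos1 _)|exact: int_mul (cos1 _) (sin1 _)].
  rewrite (factor _ _ _ _ msu mcv (sin1 _) (cos1 _))
    (factor _ _ _ _ mcu msv (cos1 _) (sin1 _)).
  by rewrite addrC.
Qed.

Lemma charfun_add_independent (X Y : {RV P >-> R}) (u : R) :
  independent_pair P X Y ->
  charfun P (X \+ Y) u = charfun P X u * charfun P Y u.
Proof.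
move=> /cexpectation_expj_independent <-; congr cexpectation.
by apply/funext => w; rewrite mulrDr.
Qed.

End CharacteristicFunction.

(** * Pairwise independence extracted from families of variables *)

Section Independence.
Context {d : measure_display} {T : measurableType d} {R : realType}.
Variable P : probability T R.

Lemma sigma_of_family_preimage (I : Type) (X : I -> T -> R) i (B : set R) :
  measurable B -> sigma_of_family X (X i @^-1` B).
Proof. by move=> mB; apply: sub_sigma_algebra; exists i, B. Qed.

(** Brings sums such as [alpha n + beta m] within reach of [independent_families], which speaks of
    all events generated by a family. *)
Lemma sigma_of_family_add (I : Type) (X : I -> T -> R) i k (B : set R) :
  measurable B -> sigma_of_family X ((X i \+ X k) @^-1` B).
Proof.
move=> mB.
pose G := [set A | exists i (B : set R), measurable B /\ A = X i @^-1` B].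
(* Once the sample space carries the generated sigma-algebra, each [X j] is measurable by
   construction, and so are sums. *)
have mX j : measurable_fun (setT : set (g_sigma_algebraType G)) (X j).
  by move=> _ C mC; rewrite setTI; exact: sigma_of_family_preimage.
have /(_ measurableT B mB) := measurable_funD (mX i) (mX k).
by rewrite setTI.
Qed.

Lemma independent_families_pair (I J : Type) (X : I -> T -> R)
    (Y : J -> T -> R) i j :
  independent_families P X Y -> independent_pair P (X i) (Y j).
Proof.
by move=> indep A B mA mB; apply: indep; exact: sigma_of_family_preimage.
Qed.

Lemma mutually_independent_pair (I : finType) (X : I -> T -> R) i j :
  i != j -> mutually_independent P X -> independent_pair P (X i) (X j).
Proof.
move=> ij indep A B mA mB.
(* The subfamily is the pair [i], [j]; the value [B] at indices other than these two never
   enters. *)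
have := indep [set i; j]%SET (fun k => if k == i then A else B).
rewrite big_setU1 ?inE//= big_set1 eqxx eq_sym (negbTE ij) => <-; last first.
  by move=> k; case: ifP.
congr (P _); apply/seteqP; split => w /=.
  move=> [Aw Bw] k; rewrite /= !inE => /orP[] /eqP ->; first by rewrite eqxx.
  by rewrite eq_sym (negbTE ij).
move=> H; split; first by have := H i; rewrite /= !inE eqxx; apply.
by have := H j; rewrite /= !inE eqxx orbT eq_sym (negbTE ij); apply.
Qed.

End Independence.

(** * Differences on an equally spaced grid *)

Section EquallySpaced.
Context {R : realType} (n : nat) (x : 'I_n -> R).
Hypothesis x_uniform : equally_spaced x.

(** By telescoping, the difference is [k - i] steps, which is also the displacement from the first
    point to the one of index [k - i]. *)
Lemma equally_spaced_sub (i0 i k : 'I_n) : i0 = 0%N :> nat -> (i <= k)%N ->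
  exists2 j : 'I_n, j = (k - i)%N :> nat & x k - x i = x j - x i0.
Proof.
move=> i0E ik; have [step stepE] := x_uniform.
have subE m (a b : 'I_n) : b = (a + m)%N :> nat -> x b - x a = step *+ m.
  elim: m b => [|m IHm] b bE.
    by rewrite (_ : b = a) ?subrr//; apply: val_inj; rewrite /= bE addn0.
  have ltb : (a + m < n)%N by rewrite ltnW// -addnS -bE.
  rewrite mulrS -(IHm (Ordinal ltb))// -(stepE (Ordinal ltb) b) ?bE ?addnS//.
  by rewrite addrA subrK.
have ltj : (k - i < n)%N by rewrite (leq_ltn_trans (leq_subr _ _)).
exists (Ordinal ltj) => //.
by rewrite (subE (k - i)%N) ?subnKC// (subE (k - i)%N) ?i0E.
Qed.

(** For [i < k] the difference is one taken from the first point; for [k < i] it is the opposite of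
    such a difference, and conjugation preserves zero. *)
Lemma equally_spaced_vanish (psi : R -> R[i]) (c : R) (i0 : 'I_n) :
  (forall u, psi (- u) = (psi u)^*) -> i0 = 0%N :> nat ->
  (forall j : 'I_n, (0 < j)%N -> psi (c * (x j - x i0)) = 0) ->
  forall i k : 'I_n, i != k -> psi (c * (x k - x i)) = 0.
Proof.
move=> psiN i0E psi0.
have psi_lt (i k : 'I_n) : (i < k)%N -> psi (c * (x k - x i)) = 0.
  move=> ik; have [j jE ->] := equally_spaced_sub i0E (ltnW ik).
  by rewrite psi0// jE subn_gt0.
move=> i k ik; have [/psi_lt//|ki|/val_inj ikE] := ltngtP i k.
  by rewrite -opprB mulrN psiN psi_lt// conjC0.
by rewrite ikE eqxx in ik.
Qed.

End EquallySpaced.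

(** * Isotropy and zeros of the characteristic functions *)

Theorem theorem3 (R : realType)
  (lambda Tc AT AR : R) (NT NR P Pmax GD GT : nat)
  (lambda_gt0 : 0 < lambda) (Tc_gt0 : 0 < Tc) (AT_gt0 : 0 < AT)
  (AR_gt0 : 0 < AR) (NT_gt0 : (0 < NT)%N) (NR_gt0 : (0 < NR)%N)
  (P_gt0 : (0 < P)%N) (P_lt : (P < Pmax)%N)
  (GD_gt0 : (0 < GD)%N) (GT_gt0 : (0 < GT)%N)
  (* laws of the transmitter positions, receiver positions, chirp indices *)
  (Palpha Pbeta Pp : probability R R)
  (Palpha_supp :
    Palpha `[- (AT / (AT + AR)), AT / (AT + AR)]%classic = 1%E)
  (Palpha_even : symmetric_about 0 Palpha)
  (Pbeta_supp :
    Pbeta `[- (AR / (AT + AR)), AR / (AT + AR)]%classic = 1%E)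
  (Pbeta_even : symmetric_about 0 Pbeta)
  (Pp_sym : symmetric_about ((Pmax%:R - 1) / 2) Pp)
  (* the random positions and chirp indices *)
  (d : measure_display) (Omega : measurableType d) (Pr : probability Omega R)
  (alpha : 'I_NT -> {RV Pr >-> R}) (beta : 'I_NR -> {RV Pr >-> R})
  (zeta : 'I_P -> {RV Pr >-> R})
  (alpha_law : forall n, has_law (alpha n) Palpha)
  (beta_law : forall m, has_law (beta m) Pbeta)
  (positions_indep : mutually_independent Pr
    (join_families (fun n => alpha n : Omega -> R)
                   (fun m => beta m : Omega -> R)))
  (zeta_law : forall p, has_law (zeta p) Pp)
  (zeta_range : {ae Pr, forall w, forall p,
    exists2 k : nat, (k < Pmax)%N & zeta p w = k%:R})
  (zeta_distinct : {ae Pr, forall w, injective (fun p => zeta p w)})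
  (zeta_positions_indep : independent_families Pr
    (fun p => zeta p : Omega -> R)
    (join_families (fun n => alpha n : Omega -> R)
                   (fun m => beta m : Omega -> R)))
  (* xi = alpha + beta for a generic transmitter and a generic receiver *)
  (d' : measure_display) (Omega' : measurableType d')
  (Q : probability Omega' R) (alpha0 beta0 : {RV Q >-> R})
  (alpha0_law : has_law alpha0 Palpha) (beta0_law : has_law beta0 Pbeta)
  (generic_indep : independent_families Q
    (fun _ : unit => alpha0 : Omega' -> R)
    (fun _ : unit => beta0 : Omega' -> R))
  (xi : {RV Q >-> R}) (xi_def : forall w, xi w = alpha0 w + beta0 w)
  (* grids, and the order of the pairs (n, m) labelling the rows of C *)
  (rho : 'I_GD -> R) (rho_uniform : equally_spaced rho)
  (phi : 'I_GT -> R) (phi_uniform : equally_spaced (fun i => sin (phi i)))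
  (pair : 'I_(NT * NR) -> 'I_NT * 'I_NR) (pair_bij : bijective pair) :
  isotropic Pr (fun w =>
    matD lambda Tc (AT + AR) rho pair phi
      (fun p => zeta p w) (fun n => alpha n w) (fun m => beta m w))
  <->
  (forall i : 'I_GD, (0 < i)%N ->
     charfun Pp idfun (uD lambda Tc rho (Ordinal GD_gt0) i) = 0) /\
  (forall i : 'I_GT, (0 < i)%N ->
     charfun Q xi (utheta lambda (AT + AR) phi (Ordinal GT_gt0) i) = 0).
Proof.
pose positions := join_families (fun n => alpha n : Omega -> R)
  (fun m => beta m : Omega -> R).
set uDi := uD lambda Tc rho; set uTi := utheta lambda (AT + AR) phi.
(* The generic pair lives on its own probability space, so [xi] and [alpha n + beta m] are compared
   through the laws [Palpha] and [Pbeta]. *)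
have xi_law v : charfun Q xi v = charfun Palpha idfun v * charfun Pbeta idfun v.
  have -> : (xi : Omega' -> R) = alpha0 \+ beta0 by exact/funext.
  rewrite charfun_add_independent.
    by rewrite (charfun_law _ alpha0_law) (charfun_law _ beta0_law).
  exact: independent_families_pair tt tt generic_indep.
have pos_law n m v : charfun Pr (alpha n \+ beta m) v = charfun Q xi v.
  rewrite charfun_add_independent.
    by rewrite (charfun_law _ (alpha_law n)) (charfun_law _ (beta_law m))
      xi_law.
  exact: (@mutually_independent_pair _ _ _ _ _ _ (inl n) (inr m) isT
    positions_indep).
(* The right-hand side is free of the row [(p, q)]: all rows impose the same conditions. *)
have entryE p q i k j l : mxexpectation Pr (fun w =>
    (row (mxtens_index (p, q)) (matD lambda Tc (AT + AR) rho pair phi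
      (fun p => zeta p w) (fun n => alpha n w) (fun m => beta m w)) ^t*)%sesqui
    *m row (mxtens_index (p, q)) (matD lambda Tc (AT + AR) rho pair phi
      (fun p => zeta p w) (fun n => alpha n w) (fun m => beta m w)))
    (mxtens_index (i, j)) (mxtens_index (k, l)) =
  charfun Pp idfun (uDi i k) * charfun Q xi (uTi j l).
  rewrite mxE -(charfun_law _ (zeta_law p)) -(pos_law (pair q).1 (pair q).2).
  rewrite -cexpectation_expj_independent; last first.
    move=> A B mA mB; apply: zeta_positions_indep.
      exact: sigma_of_family_preimage.
    exact: (@sigma_of_family_add _ _ _ _ positions
      (inl (pair q).1) (inr (pair q).2)).
  congr cexpectation; apply/funext => w.
  (* The inner dimension is 1, so the entry is a single product of a conjugate entry and an entry,
     whose phases add. *)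
  rewrite mxE big_ord1 !mxE !mxtens_indexK rmorphM /= !conjc_expj -!expjD.
  congr expj; rewrite /uDi /uTi /uD /utheta /=.
  ring.
have xi0 j : charfun Q xi (uTi j j) = 1.
  by rewrite /uTi /utheta subrr mulr0 charfun0.
have zeta0 i : charfun Pp idfun (uDi i i) = 1.
  by rewrite /uDi /uD subrr mulr0 charfun0.
split=> [iso|[zeta_vanish xi_vanish] l0].
  (* One row is enough in this direction; it exists because [P], [NT] and [NR] are positive. *)
  pose p0 : 'I_P := Ordinal P_gt0.
  have NTR_gt0 : (0 < NT * NR)%N by rewrite muln_gt0 NT_gt0.
  have iso0 i k j l : charfun Pp idfun (uDi i k) * charfun Q xi (uTi j l) =
      ((i == k) && (j == l))%:R.
    rewrite -(entryE p0 (Ordinal NTR_gt0)) iso mxE.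
    by rewrite (can_eq (@mxtens_indexK _ _)).
  split=> i i_gt0.
    (* Equal angular indices make the factor of [xi] equal to 1 and isolate that of [Pp]; equal
       Doppler indices do the converse below. *)
    have := iso0 (Ordinal GD_gt0) i (Ordinal GT_gt0) (Ordinal GT_gt0).
    by rewrite xi0 mulr1 eqxx andbT -val_eqE /= eq_sym gtn_eqF.
  have := iso0 (Ordinal GD_gt0) (Ordinal GD_gt0) (Ordinal GT_gt0) i.
  by rewrite zeta0 mul1r eqxx /= -val_eqE /= eq_sym gtn_eqF.
apply/matrixP => a b.
rewrite -(mxtens_unindexK l0) -(mxtens_unindexK a) -(mxtens_unindexK b).
move: (mxtens_unindex l0) (mxtens_unindex a) (mxtens_unindex b).
move=> [p q] [i j] [k l].
rewrite entryE mxE (can_eq (@mxtens_indexK _ _)) xpair_eqE.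
(* Off the diagonal either the Doppler indices differ and the first factor vanishes, or the angular
   ones differ and the second does. *)
have [->|ik] := eqVneq i k; last first.
  rewrite /= (equally_spaced_vanish rho_uniform (i0 := Ordinal GD_gt0))
    ?mul0r//.
  (* Conjugate symmetry for [Pp] is obtained from the random variable [zeta p], which has this
     law. *)
  by move=> u; rewrite -!(charfun_law _ (zeta_law p)) charfunN.
have [->|jl] := eqVneq j l; first by rewrite zeta0 xi0 mulr1.
rewrite (equally_spaced_vanish phi_uniform (i0 := Ordinal GT_gt0)
  (psi := charfun Q xi)) ?mulr0//.
exact: charfunN.
Qed.
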